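(* For every $k$, there is a finite tree $T$ of maximum degree $3$ with $\mathsf{in}(T)>k$.
   Context: Zero-visibility $k$-search game on a finite simple graph $G$: an invisible intruder occupies a vertex; players alternate starting with the searcher; on each turn the searcher inspects an arbitrary set of $k$ vertices and wins if the intruder is at one of them; otherwise the intruder may move to an adjacent vertex or stay. The inspection number $\mathsf{in}(G)$ is the least $k$ for which the searcher has a finite sequence of moves guaranteeing capture regardless of the intruder's start and moves. *)

(* Defs.v *)
From mathcomp Require Import all_boot.
From mathcomp Require Import boolp.

Set Implicit Arguments.
Unset Strict Implicit.
Unset Printing Implicit Defensive.

Section Graphs.
Variable V : finType.
Implicit Type e : rel V.

Definition simple_graph e : Prop := symmetric e /\ irreflexive e.

Definition connected_graph e : Prop :=
  0 < #|V| /\ forall x y : V, connect e x y.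

(* In path.v, a [ucycle] of size 1 is a loop and one of size 2 is an edge
   traversed back and forth; only those of size at least 3 are graph cycles. *)
Definition acyclic_graph e : Prop :=
  forall c : seq V, ucycle e c -> size c < 3.

Definition tree e : Prop :=
  [/\ simple_graph e, connected_graph e & acyclic_graph e].

Definition degree e (x : V) : nat := #|[set y | e x y]|.

Definition max_degree e : nat := \max_(x : V) degree e x.

(* [w i] is the position of the intruder at the searcher's [i]-th inspection. *)
Definition intruder_walk e (w : nat -> V) : Prop :=
  forall i, w i.+1 = w i \/ e (w i) (w i.+1).

(* The searcher learns nothing before capture, so a strategy is a sequence of
   inspected sets fixed in advance. *)
Definition winning_strategy e (k : nat) (s : seq {set V}) : Prop :=
  (forall S, S \in s -> #|S| = k) /\
  forall w, intruder_walk e w -> exists2 i, i < size s & w i \in nth set0 s i.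

Definition searcher_wins e (k : nat) : Prop :=
  exists s : seq {set V}, winning_strategy e k s.

Lemma searcher_wins_ex e : exists k, `[< searcher_wins e k >].
Proof.
exists #|V|; apply/asboolP; exists [:: setT]; split=> [S|w _].
  by rewrite inE => /eqP ->; rewrite cardsT.
by exists 0; rewrite ?inE.
Qed.

Definition inspection_number e : nat := ex_minn (searcher_wins_ex e).

End Graphs.

(* Main.v *)
(* If the intruder may be at any vertex of C, then after his move and an
   inspection of at most k vertices at least |N[C]| - k vertices remain possible,
   so the searcher loses once every vertex set with size in some window of k
   consecutive integers has at least k outer boundary vertices.  In a complete
   binary tree, cutting the edges between C and its complement expresses |C| as
   a signed sum of subtree sizes 2^h - 1, with about as many terms as there are
   cut edges.  Hence sizes that are not a signed sum of few powers of two force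
   a large boundary, and there are arbitrarily long intervals of such
   integers. *)
Require Import Defs.
From mathcomp Require Import all_boot.
From mathcomp Require Import boolp zify.

Set Implicit Arguments.
Unset Strict Implicit.
Unset Printing Implicit Defensive.

(** * Contaminated sets and the search game *)

Section Game.
Variables (V : finType) (e : rel V).

Definition closed_nbhd (C : {set V}) : {set V} :=
  C :|: [set y | [exists x in C, e x y]].

Definition outer_boundary (C : {set V}) : {set V} := closed_nbhd C :\: C.

Fixpoint contaminated (s : nat -> {set V}) (i : nat) : {set V} :=
  if i is i'.+1 then closed_nbhd (contaminated s i') :\: s i'.+1 else ~: s 0.

Lemma card_closed_nbhd (C : {set V}) :
  #|closed_nbhd C| = #|C| + #|outer_boundary C|.
Proof.
rewrite -(cardsID C (closed_nbhd C)); congr (#|pred_of_set _| + _).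
by apply/setIidPr; apply: subsetUl.
Qed.

(** Induction on rounds builds an actual intruder trajectory, frozen at [x] after time [i] to make
    it infinite. *)
Lemma contaminated_walk (s : nat -> {set V}) i x :
  x \in contaminated s i ->
  exists w, [/\ intruder_walk e w, w i = x & forall j, j <= i -> w j \notin s j].
Proof.
elim: i x => [|i IHi] x /=.
  rewrite inE => xS; exists (fun=> x); split=> [j||j]; first by left.
    by [].
  by rewrite leqn0 => /eqP ->.
rewrite !inE => /andP[xS xN].
have [y yC xy] : exists2 y, y \in contaminated s i & x = y \/ e y x.
  case/orP: xN => [xC|/existsP[y /andP[yC yx]]]; first by exists x => //; left.
  by exists y => //; right.
have [w [walk_w wi w_avoids]] := IHi y yC.
exists (fun j => if j <= i then w j else x); split=> [j||j].
- have [ltji|lt_ij|->] := ltngtP j i.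
  + by rewrite ?ltji ?(ltnW ltji); apply: walk_w.
  + by left.
  + by rewrite ?ltnn ?leqnn ?wi.
- by rewrite ltnn.
- case: (leqP j i) => [le_ji _|lt_ij le_ji]; first exact: w_avoids.
  by have -> : j = i.+1 by lia.
Qed.

(* One inspection round turns [C] into a set of size at least
   #|closed_nbhd C| - k, so the size can neither jump over the window
   [m, m + k) nor decrease inside it. *)
Lemma isoperimetric_searcher_loses (k m j : nat) :
  m + k <= #|V| -> 0 < m -> j <= k ->
  (forall C : {set V}, m <= #|C| < m + k -> k <= #|outer_boundary C|) ->
  ~ searcher_wins e j.
Proof.
move=> mk_le m_gt0 le_jk iso [s [card_s win]].
have card_nth i : #|nth set0 s i| <= k.
  case: (ltnP i (size s)) => [lt_is|le_si].
    by rewrite card_s ?mem_nth.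
  by rewrite nth_default ?cards0.
have card_contaminated i : m <= #|contaminated (nth set0 s) i|.
  elim: i => [|i IHi] /=.
    have := cardsC (nth set0 s 0); have := card_nth 0; lia.
  set C := contaminated _ i in IHi *.
  have := cardsID (nth set0 s i.+1) (closed_nbhd C).
  have := subset_leq_card (subsetIr (closed_nbhd C) (nth set0 s i.+1)).
  have := card_nth i.+1; have := card_closed_nbhd C; have := iso C.
  case: (ltnP #|C| (m + k)) => [ltC /(_ _)|]; last lia.
  by rewrite IHi => /(_ isT); lia.
(* Past the end of [s] the default [set0] is inspected, so a vertex possible after round [size s]
   gives a walk escaping all of [s]. *)
have /card_gt0P[x xC] := leq_trans m_gt0 (card_contaminated (size s)).
have [w [walk_w _ w_avoids]] := contaminated_walk xC.
have [i /ltnW le_is] := win w walk_w.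
by apply/negP/w_avoids.
Qed.

End Game.

(** * Signed binary weight *)

(* The least number of terms in a representation of [x] as a signed sum of
   powers of two, computed up to [n] binary digits. *)
Fixpoint signed_weight (n x : nat) : nat :=
  if n is n'.+1 then
    if odd x then
      (minn (signed_weight n' x./2) (signed_weight n' x./2.+1)).+1
    else signed_weight n' x./2
  else 0.

Lemma signed_weight0 n : signed_weight n 0 = 0.
Proof. by elim: n. Qed.

Lemma signed_weight_even n x :
  signed_weight n.+1 x.*2 = signed_weight n x.
Proof. by rewrite /= odd_double doubleK. Qed.

Lemma signed_weight_odd n x :
  signed_weight n.+1 x.*2.+1 =
  (minn (signed_weight n x) (signed_weight n x.+1)).+1.
Proof. by rewrite /= odd_double /= uphalf_double. Qed.

(** Halving [x] halves the shift, down to a shift by one, which only involves two consecutive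
    halves. *)
Lemma signed_weight_lipschitz n x h :
  signed_weight n (x + 2 ^ h) <= (signed_weight n x).+1 /\
  signed_weight n x <= (signed_weight n (x + 2 ^ h)).+1.
Proof.
elim: n x h => [|n IHn] x h //.
rewrite -(odd_double_half x); move: x./2 => y.
case: h => [|h].
  have := IHn y 0; rewrite expn0 addn1.
  case: (odd x); rewrite ?add0n ?add1n ?addn1 -?doubleS;
    rewrite ?signed_weight_even ?signed_weight_odd; lia.
rewrite expnS mul2n -addnA -doubleD.
have := IHn y h; have := IHn y.+1 h; rewrite addSn.
case: (odd x); rewrite ?add0n ?add1n ?signed_weight_even ?signed_weight_odd; lia.
Qed.

(** The shift is the size of a complete binary subtree of height [h], a difference of two powers of
    two. *)
Lemma signed_weight_lipschitz_pred n x h :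
  signed_weight n (x + (2 ^ h).-1) <= signed_weight n x + 2 /\
  signed_weight n x <= signed_weight n (x + (2 ^ h).-1) + 2.
Proof.
have := signed_weight_lipschitz n x h.
have := signed_weight_lipschitz n (x + (2 ^ h).-1) 0.
have -> : x + (2 ^ h).-1 + 2 ^ 0 = x + 2 ^ h.
  by have := expn_gt0 2 h; rewrite expn0; lia.
lia.
Qed.

(** Rounding half of [x] up or down keeps it in the same interval with [p] lowered by one, so the
    descent ends at [a] or [a.+1]. *)
Lemma signed_weight_window K n a p x :
  K <= signed_weight n a -> K <= signed_weight n a.+1 ->
  2 ^ p * a <= x <= 2 ^ p * a.+1 -> K <= signed_weight (n + p) x.
Proof.
move=> Ka KaS; elim: p x => [|p IHp] x.
  rewrite expn0 !mul1n addn0 => /andP[ax xa].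
  have [->|->] : x = a \/ x = a.+1 by lia.
  - exact: Ka.
  - exact: KaS.
rewrite addnS expnS -!mulnA; move: (2 ^ p * a) (2 ^ p * a.+1) IHp => b c IHp.
rewrite -(odd_double_half x); move: x./2 => y.
case: (odd x) => bxc; rewrite ?add0n ?add1n ?signed_weight_even ?signed_weight_odd.
  by apply: leqW; rewrite leq_min; apply/andP; split; apply: IHp; lia.
by apply: IHp; lia.
Qed.

Lemma signed_weight_large_pair c :
  exists n a, c <= signed_weight n a /\ c <= signed_weight n a.+1.
Proof.
elim: c => [|c [n [a [ca caS]]]]; first by exists 0, 0.
(* The halves of [4a + 1] are [2a] and [2a + 1], and [4a + 2] is twice [2a + 1]; each odd number
   costs one extra term. *)
exists n.+2, a.*2.*2.+1; split.
  by rewrite signed_weight_odd signed_weight_even signed_weight_odd; lia.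
by rewrite -doubleS signed_weight_even signed_weight_odd; lia.
Qed.

Lemma signed_weight_large_window c k :
  exists n m, 0 < m /\
    forall x, m <= x < m + k -> c <= signed_weight n x.
Proof.
(* Asking for [c.+1] forces [a > 0], since 0 has weight 0. *)
have [n [a [ca caS]]] := signed_weight_large_pair c.+1.
exists (n + k), (2 ^ k * a); split.
  rewrite muln_gt0 expn_gt0 /=.
  by case: a ca {caS} => //; rewrite signed_weight0.
move=> x /andP[mx xm]; apply: ltnW.
apply: signed_weight_window ca caS _; rewrite mx mulnS.
by have := ltn_expl k (isT : 1 < 2); lia.
Qed.

(** * Subtree sums in the infinite binary tree *)

(* Sum of [f] over the [h] top levels of the subtree rooted at [v] in the
   infinite binary tree where [v] has children [2v] and [2v + 1]. *)
Fixpoint subtree_sum (f : nat -> nat) (h v : nat) : nat :=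
  if h is h'.+1 then
    f v + (subtree_sum f h' v.*2 + subtree_sum f h' v.*2.+1)
  else 0.

Lemma subtree_sum_levels f h v :
  subtree_sum f h v =
  \sum_(l < h) \sum_(2 ^ l * v <= i < 2 ^ l * v.+1) f i.
Proof.
elim: h v => [|h IHh] v /=; first by rewrite big_ord0.
rewrite big_ord_recl !IHh expn0 !mul1n big_nat1 -big_split /=; congr (_ + _).
apply: eq_bigr => l _; rewrite /bump /= add1n expnSr -!mulnA !mul2n doubleS.
by rewrite [RHS](@big_cat_nat _ _ _ (2 ^ l * v.*2.+1)) ?leq_mul2l ?leqnSn ?orbT.
Qed.

Lemma subtree_sum1 f d : subtree_sum f d 1 = \sum_(1 <= i < 2 ^ d) f i.
Proof.
rewrite subtree_sum_levels; elim: d => [|d IHd].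
  by rewrite big_ord0 big_geq.
rewrite big_ord_recr /= IHd muln1 expnSr.
by rewrite [RHS](@big_cat_nat _ _ _ (2 ^ d)) ?expn_gt0 //= leq_pmulr.
Qed.

(** Making [chi] constant below the parent [v./2] costs two per cut edge, each changing the sum by a
    full subtree size. The free [y] absorbs the rest of the sum while one child subtree is
    treated. *)
Lemma signed_weight_subtree_sum (chi : nat -> bool) n y h v :
  signed_weight n (y + subtree_sum chi h v) <=
  signed_weight n (y + chi v./2 * (2 ^ h).-1) +
  2 * subtree_sum (fun i => chi i != chi i./2) h v.
Proof.
elim: h y v => [|h IHh] y v /=; first by rewrite !muln0 !addn0.
have := IHh (y + chi v + subtree_sum chi h v.*2) v.*2.+1.
have := IHh (y + chi v + chi v * (2 ^ h).-1) v.*2.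
rewrite /= uphalf_double doubleK.
have -> : y + chi v + chi v * (2 ^ h).-1 + subtree_sum chi h v.*2 =
          y + chi v + subtree_sum chi h v.*2 + chi v * (2 ^ h).-1 by lia.
have -> : y + chi v + chi v * (2 ^ h).-1 + chi v * (2 ^ h).-1 =
          y + chi v * (2 ^ h.+1).-1.
  by have := expn_gt0 2 h; rewrite expnS; case: (chi v); lia.
rewrite -!addnA.
have := signed_weight_lipschitz_pred n y h.+1.
case: (chi v); case: (chi v./2); rewrite /= ?mul0n ?mul1n ?addn0; lia.
Qed.

Lemma sum_half (g : nat -> nat) n :
  \sum_(0 <= i < n.*2) g i./2 = 2 * \sum_(0 <= i < n) g i.
Proof.
elim: n => [|n IHn]; first by rewrite !big_geq.
by rewrite doubleS !big_nat_recr //= uphalf_double doubleK IHn; lia.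
Qed.

(** Heap numbering: the parent of [i] is [i./2]. Vertex 0 is an extra leaf attached to the root 1;
    [i != j] removes its loop. *)
Definition heap_edge (N : nat) : rel 'I_N :=
  fun i j => (i != j) && ((i == j./2 :> nat) || (j == i./2 :> nat)).

(** * The finite heap tree and its edge boundary *)

Section HeapTree.
Variable N : nat.
Local Notation e := (@heap_edge N).

Lemma heap_edge_sym : symmetric e.
Proof. by move=> i j; rewrite /heap_edge eq_sym orbC. Qed.

Lemma heap_edge_irr : irreflexive e.
Proof. by move=> i; rewrite /heap_edge eqxx. Qed.

Lemma heap_edge_lt (i j : 'I_N) : e i j -> j < i -> j = i./2 :> nat.
Proof. by case/andP=> _ /orP[/eqP|/eqP]; lia. Qed.

Lemma heap_connected : 0 < N -> connected_graph e.
Proof.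
move=> N_gt0; split=> [|x y]; first by rewrite card_ord.
pose r := Ordinal N_gt0.
have to_root (z : 'I_N) : connect e z r.
  have [n] := ubnP (z : nat); elim: n z => // n IHn z lt_zn.
  have [z0|z_gt0] := posnP z.
    by have -> : z = r by apply: val_inj.
  have lt_hN : z./2 < N by have := ltn_ord z; lia.
  apply: (connect_trans (y := Ordinal lt_hN)); last by apply: IHn => /=; lia.
  apply: connect1; rewrite /heap_edge -val_eqE /= eqxx orbT andbT; lia.
apply: connect_trans (to_root x) _.
by rewrite (sym_connect_sym heap_edge_sym).
Qed.

(* The two neighbours of the largest vertex of a cycle would both be its
   parent. *)
Lemma heap_acyclic : acyclic_graph e.
Proof.
move=> c /andP[cyc_c uniq_c]; rewrite ltnNge; apply/negP => size_c.
case: c => [|x0 c0] // in cyc_c uniq_c size_c *.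
have [x xc xmax] : exists2 x, x \in x0 :: c0 & forall y, y \in x0 :: c0 -> y <= x.
  by case: (@arg_maxnP _ x0 (fun x => x \in x0 :: c0) (@nat_of_ord N)
              (mem_head _ _)) => x xc xmax; exists x.
have [i [|y [|z c']] def_c] := rot_to xc;
  try by have := size_rot i (x0 :: c0); rewrite def_c; move: size_c => /=; lia.
have cyc' : cycle e [:: x, y, z & c'] by rewrite -def_c rot_cycle.
have uniq' : uniq [:: x, y, z & c'] by rewrite -def_c rot_uniq.
have lt_x t : t \in [:: y, z & c'] -> t < x.
  move=> tc; rewrite ltn_neqAle; apply/andP; split.
    by apply: contraTneq uniq' => /val_inj <-; rewrite /= tc.
  by apply: xmax; rewrite -(mem_rot i) def_c inE tc orbT.
move: cyc'; rewrite /= rcons_path => /and4P[exy _ _ elx].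
have lyx := lt_x y (mem_head _ _).
have llx : last z c' < x := lt_x _ (mem_last y (z :: c')).
have yl : y = last z c'.
  apply: val_inj => /=; rewrite (heap_edge_lt exy) //.
  by rewrite (heap_edge_lt (i := x) (j := last z c')) // heap_edge_sym.
by case/and3P: uniq' => _ /negP[]; rewrite yl mem_last.
Qed.

Lemma heap_tree : 0 < N -> tree e.
Proof.
move=> N_gt0; split.
- by split; [apply: heap_edge_sym | apply: heap_edge_irr].
- exact: heap_connected.
- exact: heap_acyclic.
Qed.

Lemma heap_degree_le3 x : degree e x <= 3.
Proof.
have sub : {subset map val (enum [set y | e x y]) <= [:: x./2; x.*2; x.*2.+1]}.
  move=> _ /mapP[y + ->]; rewrite mem_enum inE => /andP[_ /orP[]/eqP exy].
    rewrite !inE /=; have := odd_double_half y; rewrite -exy.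
    by case: (odd y) => /= <-; rewrite ?add1n ?add0n eqxx ?orbT.
  by rewrite !inE /= -exy eqxx.
have /uniq_leq_size/(_ sub) : uniq (map val (enum [set y | e x y])).
  by rewrite (map_inj_uniq val_inj) enum_uniq.
by rewrite size_map -cardE.
Qed.

Lemma heap_max_degree : 3 < N -> max_degree e = 3.
Proof.
move=> N_gt3; apply/eqP; rewrite eqn_leq; apply/andP; split.
  by apply/bigmax_leqP => x _; apply: heap_degree_le3.
have lt1 : 1 < N by lia.
(* Vertex 1 has the three neighbours 0, 2 and 3. *)
apply: leq_trans (leq_bigmax (Ordinal lt1)).
have lt0 : 0 < N by lia.
have lt2 : 2 < N by lia.
rewrite /degree.
have sub : [set Ordinal lt0; Ordinal lt2; Ordinal N_gt3]
             \subset [set y | e (Ordinal lt1) y].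
  by apply/subsetP => y; rewrite !inE => /orP[/orP[]|] /eqP ->.
by apply: leq_trans (subset_leq_card sub); rewrite -setUA !cardsU1 cards1 !inE -!val_eqE.
Qed.

Definition nat_indicator (C : {set 'I_N}) (i : nat) : bool :=
  if insub i is Some x then x \in C else false.

Lemma nat_indicator_ord C (x : 'I_N) : nat_indicator C x = (x \in C).
Proof. by rewrite /nat_indicator valK. Qed.

Lemma sum_nat_indicator C : \sum_(0 <= i < N) nat_indicator C i = #|C|.
Proof.
rewrite big_mkord -sum1_card [RHS]big_mkcond /=; apply: eq_bigr => x _.
by rewrite nat_indicator_ord; case: (x \in C).
Qed.

(* Each edge with exactly one end in [C] is charged to its end outside [C]. *)
Lemma heap_edge_boundary C i : i < N ->
  (nat_indicator C i != nat_indicator C i./2) <=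
  nat_indicator (outer_boundary e C) i + nat_indicator (outer_boundary e C) i./2.
Proof.
move=> lt_iN; have lt_hN : i./2 < N by lia.
have [i0|i_gt0] := posnP i; first by rewrite i0 eqxx.
rewrite -[i]/(nat_of_ord (Ordinal lt_iN)).
rewrite -[_./2]/(nat_of_ord (Ordinal lt_hN)) !nat_indicator_ord.
set x := Ordinal lt_iN; set y := Ordinal lt_hN.
have exy : e x y by rewrite /heap_edge -val_eqE /= eqxx orbT andbT; lia.
have in_boundary u v : e u v -> u \in C -> v \notin C -> v \in outer_boundary e C.
  move=> uv uC vC; rewrite !inE vC /= orbC.
  by apply/orP; left; apply/existsP; exists u; rewrite uC.
have [xC|xC] := boolP (x \in C); have [yC|yC] := boolP (y \in C) => //.
  by rewrite (in_boundary x y) ?leq_addl.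
by rewrite (in_boundary y x) ?leq_addr // heap_edge_sym.
Qed.

End HeapTree.

(** * From boundary size to inspection number *)

Lemma signed_weight_heap_set n d (C : {set 'I_(2 ^ d.+1)}) :
  signed_weight n #|C| <= 1 + 6 * #|outer_boundary (@heap_edge _) C|.
Proof.
set B := outer_boundary _ C.
have lt0 : 0 < 2 ^ d.+1 by rewrite expn_gt0.
pose chi := nat_indicator C.
(* A boundary vertex is charged at most once for the edge to its parent and twice for those to its
   children. *)
have sum_edges : \sum_(1 <= i < 2 ^ d.+1) (chi i != chi i./2) <= 3 * #|B|.
  apply: (@leq_trans (\sum_(0 <= i < 2 ^ d.+1)
            (nat_indicator B i + nat_indicator B i./2))).
    rewrite [leqRHS]big_ltn // big_nat_cond [in leqRHS]big_nat_cond.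
    apply: leq_trans (leq_addl _ _); apply: leq_sum => i.
    by rewrite andbT => /andP[_]; apply: heap_edge_boundary.
  rewrite big_split /= sum_nat_indicator.
  have -> : \sum_(0 <= i < 2 ^ d.+1) nat_indicator B i./2 =
            2 * \sum_(0 <= i < 2 ^ d) nat_indicator B i.
    by rewrite -(sum_half (nat_indicator B)) -mul2n -expnS.
  have : \sum_(0 <= i < 2 ^ d) nat_indicator B i <= #|B|.
    rewrite -sum_nat_indicator [leqRHS](@big_cat_nat _ _ _ (2 ^ d)) ?leq_addr //=.
    by rewrite leq_exp2l.
  by rewrite (mulnDl 1 2) mul1n leq_add2l leq_mul2l.
have := signed_weight_subtree_sum chi n (chi 0) d.+1 1.
rewrite !subtree_sum1 -big_ltn // sum_nat_indicator.
(* Vertex 0 completes the tree below 1 to a single power of two, which accounts for the summand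
   1. *)
have -> : chi 0 + chi 1./2 * (2 ^ d.+1).-1 = chi 0 * 2 ^ d.+1.
  by rewrite -[1./2]/0; move: lt0; case: (chi 0); lia.
move=> /leq_trans; apply; apply: leq_add; last first.
  by rewrite -[6]/(2 * 3) -mulnA leq_mul2l.
have := (signed_weight_lipschitz n 0 d.+1).1; rewrite signed_weight0 add0n.
by case: (chi 0); rewrite /= ?mul1n ?mul0n ?signed_weight0.
Qed.

Theorem theorem3p4 (k : nat) :
  exists (V : finType) (e : rel V),
    [/\ tree e, max_degree e = 3 & k < inspection_number e].
Proof.
have [n [m [m_gt0 large]]] := signed_weight_large_window (1 + 6 * k) k.
(* Large enough for the window to fit below [2 ^ d.+1] and for a vertex of degree 3. *)
pose d := m + k + 1.
have lt_d : d.+1 < 2 ^ d.+1 by apply: ltn_expl.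
exists 'I_(2 ^ d.+1), (@heap_edge _); split.
- by apply: heap_tree; rewrite expn_gt0.
- by apply: heap_max_degree; rewrite (@leq_exp2l 2 2) //; lia.
rewrite /inspection_number; case: ex_minnP => j /asboolP win _.
rewrite ltnNge; apply/negP => le_jk; move: win.
apply: (@isoperimetric_searcher_loses _ _ k m) => //.
  by rewrite card_ord; lia.
move=> C /large /leq_trans/(_ (signed_weight_heap_set n C)).
by rewrite leq_add2l leq_mul2l.
Qed.
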